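(* Let $\mathcal F$ be a degenerate family of graphs satisfying $\mathrm{ex}(n,\mathcal F)=O(n^{1+\alpha})$ for some constant $\alpha\in[0,1)$, and $\tau(\mathcal F)\ge 2$. Let $p>\frac{1}{1-\alpha}$ be a real number. If $G$ is an $\mathcal F$-free graph on $n$ vertices such that $e_p(G)\ge(\tau(\mathcal F)-1-o(1))n^p$, then $G$ has exactly $\tau(\mathcal F)-1$ vertices, each of degree $(1-o(1))n$, and all remaining vertices of $G$ have degree $o(n)$. Explicitly: for every $\varepsilon>0$ there exist $\delta>0$ and $n_0$ (depending only on $\mathcal F,\alpha,p,\varepsilon$) such that for every $n\ge n_0$ and every $\mathcal F$-free graph $G$ on $n$ vertices with $e_p(G)\ge(\tau(\mathcal F)-1-\delta)n^p$, there is a set $U\subseteq V(G)$ with $|U|=\tau(\mathcal F)-1$ such that $d_G(u)\ge(1-\varepsilon)n$ for all $u\in U$ and $d_G(v)\le\varepsilon n$ for all $v\in V(G)\setminus U$.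
   Context: All graphs are finite, simple and undirected. For a graph $G$, $d_G(v)$ is the degree of $v$. For a family $\mathcal F$ of graphs, $G$ is $\mathcal F$-free if $G$ contains no $F\in\mathcal F$ as a (not necessarily induced) subgraph. $\mathrm{ex}(n,\mathcal F)$ is the maximum number of edges of an $\mathcal F$-free graph on $n$ vertices. For real $p>0$, $e_p(G)=\sum_{v\in V(G)}d_G(v)^p$. A family $\mathcal F$ is degenerate if at least one graph in $\mathcal F$ is bipartite. For a bipartite graph $F$, an independent vertex cover of $F$ is an independent set of vertices that meets every edge of $F$, and $\tau(F)$ is the minimum size of an independent vertex cover of $F$. For a degenerate family, $\tau(\mathcal F)=\min\{\tau(F):F\in\mathcal F\text{ is bipartite}\}$. The asymptotic notation $o(\cdot)$ is as $n\to\infty$. *)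

(* Defs.v *)
From mathcomp Require Import all_boot all_order all_algebra.
From mathcomp Require Import all_classical all_reals all_analysis.

Set Implicit Arguments.
Unset Strict Implicit.
Unset Printing Implicit Defensive.

Import Order.TTheory GRing.Theory Num.Theory.

Local Open Scope nat_scope.
Local Open Scope classical_set_scope.

Record sgraph := SGraph {
  vertex :> finType;
  adj : rel vertex;
  adj_sym : symmetric adj;
  adj_irrefl : irreflexive adj }.

Arguments adj {s} x y.

Definition deg (G : sgraph) (v : G) : nat := #|[set w : G | adj v w]%SET|.

Definition edges (G : sgraph) : {set {set G}} :=
  [set [set x; y] | x in G, y in G & adj x y]%SET.

(* Not necessarily induced. *)
Definition subgraph (F G : sgraph) : Prop :=
  exists f : F -> G, injective f /\ forall x y, adj x y -> adj (f x) (f y).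

(* Families may be infinite. They are plain predicates because [set sgraph] is
   a universe inconsistency: [set] is monomorphic below [finType]. *)
Definition family_free (FF : sgraph -> Prop) (G : sgraph) : Prop :=
  forall F, FF F -> ~ subgraph F G.

Lemma card_edges_le (G : sgraph) : #|edges G| <= 'C(#|G|, 2).
Proof.
rewrite -card_draws; apply/subset_leq_card/fintype.subsetP => e.
case/imset2P=> x y _; rewrite inE => /andP[_ xy] ->; rewrite inE cards2.
by case: (eqVneq x y) xy => // ->; rewrite adj_irrefl.
Qed.

(* By [card_edges_le] the range of [k] covers every possible number of edges. *)
Definition turan_number (n : nat) (FF : sgraph -> Prop) : nat :=
  \max_(k < 'C(n, 2).+1 |
    `[< exists G : sgraph, [/\ #|G| = n, family_free FF G & #|edges G| = k] >]) k.

Definition independent (G : sgraph) (S : {set G}) : bool :=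
  [forall x in S, forall y in S, ~~ adj x y].

Definition bipartite (G : sgraph) : bool :=
  [exists A : {set G}, independent A && independent (~: A)%SET].

Definition vertex_cover (G : sgraph) (S : {set G}) : bool :=
  [forall x, forall y, adj x y ==> (x \in S) || (y \in S)].

(* The default value [#|F|] is harmless: it bounds every [#|S|], and a bipartite
   [F] has an independent vertex cover, namely either of its parts. *)
Definition tau (F : sgraph) : nat :=
  \big[minn/#|F|]_(S : {set F} | independent S && vertex_cover S) #|S|.

Definition degenerate (FF : sgraph -> Prop) : Prop :=
  exists2 F, FF F & bipartite F.

Lemma degenerate_tau (FF : sgraph -> Prop) : degenerate FF ->
  exists t, `[< exists F, [/\ FF F, bipartite F & tau F = t] >].
Proof. by move=> [F FFF bF]; exists (tau F); apply/asboolP; exists F. Qed.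

Definition tau_family (FF : sgraph -> Prop) (degF : degenerate FF) : nat :=
  ex_minn (degenerate_tau degF).

Definition degree_power (R : realType) (p : R) (G : sgraph) : R :=
  (\sum_(v : G) (deg v)%:R `^ p)%R.

(* Main.v *)
(** Write [t] for [tau_family degF]. Cutting the vertex set into blocks of size
    [w] and applying the Turan bound to the union of a [w]-set [W] with each
    block shows that the degrees in [W] sum to [O(n w^alpha)]. Hence the [k]-th
    largest degree is [O(n k^(alpha - 1))]; as [p (1 - alpha) > 1], a bounded
    number of top vertices [W] carries all of [e_p] up to [eta n^p]. Any [t]
    vertices have boundedly many common neighbours, since a graph of the family
    embeds in some [K_(t,m)], so the degrees in [W] sum to at most
    [(t - 1) n + O(1)]. The normalised degrees [x_v = d(v) / n] thus satisfy
    [sum x_v <= t - 1 + eta] and [sum x_v^p >= t - 1 - 2 eta] over [W], which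
    forces each of them close to [0] or [1], with exactly [t - 1] close to [1]. *)

Require Import Defs.
From mathcomp Require Import all_boot all_order all_algebra.
From mathcomp Require Import all_classical all_reals all_analysis.
From mathcomp Require Import ring lra zify.

Import Order.TTheory GRing.Theory Num.Theory.
Import numFieldNormedType.Exports.

Set Implicit Arguments.
Unset Strict Implicit.
Unset Printing Implicit Defensive.

Local Open Scope set_scope.
Local Open Scope nat_scope.

(** * Induced subgraphs and the Turan bound *)

Lemma subgraph_trans (F G H : sgraph) :
  subgraph F G -> subgraph G H -> subgraph F H.
Proof.
move=> [f [f_inj fP]] [g [g_inj gP]]; exists (g \o f).
by split=> [|x y /fP/gP //]; apply: inj_comp.
Qed.

Definition induced_adj (G : sgraph) (X : {set G}) : rel {x | x \in X} :=
  fun x y => adj (val x) (val y).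

Lemma induced_adj_sym (G : sgraph) (X : {set G}) : symmetric (@induced_adj G X).
Proof. by move=> x y; apply: adj_sym. Qed.

Lemma induced_adj_irrefl (G : sgraph) (X : {set G}) : irreflexive (@induced_adj G X).
Proof. by move=> x; apply: adj_irrefl. Qed.

Definition induced (G : sgraph) (X : {set G}) : sgraph :=
  SGraph (@induced_adj_sym G X) (@induced_adj_irrefl G X).

Lemma induced_subgraph (G : sgraph) (X : {set G}) : subgraph (induced X) G.
Proof. by exists val; split=> //; apply: val_inj. Qed.

Lemma card_induced (G : sgraph) (X : {set G}) : #|induced X| = #|X|.
Proof. by rewrite card_sig. Qed.

Lemma induced_free FF (G : sgraph) (X : {set G}) :
  family_free FF G -> family_free FF (induced X).
Proof.
move=> frG F FFF sub.
exact: frG F FFF (subgraph_trans sub (induced_subgraph X)).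
Qed.

Lemma edges_le_turan FF (G : sgraph) :
  family_free FF G -> #|edges G| <= turan_number #|G| FF.
Proof.
move=> frG; have lt_e : #|edges G| < 'C(#|G|, 2).+1 by rewrite ltnS card_edges_le.
rewrite /turan_number.
apply: (@leq_bigmax_cond _ _ _ (Ordinal lt_e)).
by apply/asboolP; exists G.
Qed.

(** Arcs are counted fibrewise over edges: [[set x; y]] comes only from [(x, y)] and [(y, x)]. *)
Lemma card_arcs_le (G : sgraph) :
  #|[set e : G * G | adj e.1 e.2]| <= 2 * #|edges G|.
Proof.
set A := [set _ | _].
rewrite mulnC -sum_nat_const -sum1_card.
rewrite (partition_big (fun e : G * G => [set e.1; e.2]) (mem (edges G))) /=; last first.
  move=> [x y]; rewrite inE /= => xy.
  by apply/imset2P; exists x y => //; rewrite inE.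
apply: leq_sum => e /imset2P[x y _ _ ->].
rewrite sum1dep_card.
apply: leq_trans (_ : #|[set (x, y); (y, x)]| <= 2); last by rewrite cards2; case: (_ != _).
apply/subset_leq_card/fintype.subsetP => -[u v]; rewrite !inE /= => /andP[uv /eqP uvxy].
have uP : u \in [set x; y] by rewrite -uvxy set21.
have vP : v \in [set x; y] by rewrite -uvxy set22.
rewrite !xpair_eqE.
have : u != v by apply: contraTneq uv => ->; rewrite adj_irrefl.
move: uP vP; rewrite !inE => /orP[]/eqP-> /orP[]/eqP->; rewrite ?eqxx //= ?orbT //.
Qed.

(** The pairs counted are arcs of the subgraph induced on [W :|: B], which inherits freeness. Since
    [W] and [B] may overlap, an edge can be counted in both orders, whence the factor 2. *)
Lemma sum_cross_deg_le FF (G : sgraph) (W B : {set G}) : family_free FF G ->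
  \sum_(u in W) #|[set v in B | adj u v]| <= 2 * turan_number #|W :|: B| FF.
Proof.
move=> frG; pose X := W :|: B; pose H := induced X.
have ltH : 2 * #|edges H| <= 2 * turan_number #|X| FF.
  by rewrite leq_mul2l /= -(card_induced X); apply/edges_le_turan/induced_free.
apply: leq_trans ltH; apply: leq_trans (card_arcs_le H).
pose P := [set e : G * G | (e.1 \in W) && ((e.2 \in B) && adj e.1 e.2)].
have -> : \sum_(u in W) #|[set v in B | adj u v]| = #|P|.
  under eq_bigr do rewrite -sum1dep_card.
  by rewrite pair_big_dep /= sum1dep_card.
pose g (e : H * H) := (val e.1, val e.2) : G * G.
have /subset_leq_card : P \subset g @: [set e : H * H | adj e.1 e.2].
  apply/fintype.subsetP => -[u v]; rewrite inE /= => /and3P[uW vB uv].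
  have uX : u \in X by rewrite inE uW.
  have vX : v \in X by rewrite inE vB orbT.
  by apply/imsetP; exists (Sub u uX : H, Sub v vX : H); rewrite ?inE.
by move/leq_trans; apply; apply: leq_imset_card.
Qed.

(** * Cutting the vertex set into blocks *)

Lemma card_block_le n w j : 0 < w -> #|[set i : 'I_n | i %/ w == j]| <= w.
Proof.
(* Reduction modulo the block size is injective on each block. *)
case: w => // w _; pose f (i : 'I_n) : 'I_w.+1 := inord (i %% w.+1).
rewrite -[X in _ <= X](card_ord w.+1).
apply: (@leq_card_in _ _ f) => i1 i2; rewrite !inE => /eqP e1 /eqP e2 /(congr1 val).
rewrite /= !inordK ?ltn_mod // => em; apply: val_inj.
by rewrite /= (divn_eq i1 w.+1) (divn_eq i2 w.+1) e1 e2 em.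
Qed.

(** Blocks of size [#|W|] keep each [W :|: B j] within [2 * #|W|] vertices while leaving only about
    [#|G| / #|W|] blocks. *)
Lemma sum_deg_blocks (G : sgraph) (W : {set G}) : 0 < #|W| ->
  exists B : 'I_(#|G| %/ #|W|).+1 -> {set G},
    (forall j, #|B j| <= #|W|) /\
    \sum_(u in W) deg u = \sum_j \sum_(u in W) #|[set v in B j | adj u v]|.
Proof.
set w := #|W| => w0.
exists (fun j : 'I__ => [set v : G | enum_rank v %/ w == j]); split=> [j|].
  apply: leq_trans (card_block_le #|G| j w0).
  rewrite -(card_imset _ (@enum_rank_inj G)).
  apply/subset_leq_card/fintype.subsetP => _ /imsetP[v + ->].
  by rewrite !inE.
rewrite exchange_big /=; apply: eq_bigr => u _.
rewrite /deg -sum1dep_card.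
have lt_b (v : G) : enum_rank v %/ w < (#|G| %/ w).+1.
  by rewrite ltnS leq_div2r // ltnW.
rewrite (partition_big (fun v => Ordinal (lt_b v)) predT) //=.
apply: eq_bigr => j _; rewrite -sum1dep_card; apply: eq_bigl => v.
by rewrite inE andbC -val_eqE.
Qed.

(** * Independent covers and common neighbourhoods *)

Lemma tau_witness (F : sgraph) : bipartite F ->
  exists A : {set F}, [/\ independent A, vertex_cover A & #|A| = tau F].
Proof.
case/existsP=> A /andP[iA iAc].
have cA : vertex_cover A.
  apply/forallP=> x; apply/forallP=> y; apply/implyP=> xy.
  apply/negPn/negP; rewrite negb_or => /andP[xA yA].
  move/forall_inP: iAc => /(_ x); rewrite inE xA => /(_ isT).
  by move/forall_inP => /(_ y); rewrite inE yA xy => /(_ isT).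
pose Q k := [exists S : {set F}, [&& independent S, vertex_cover S & #|S| == k]].
suff /existsP[S /and3P[iS cS /eqP eS]] : Q (tau F) by exists S.
rewrite /tau.
have : (exists2 S : {set F}, S \in index_enum {set F} & independent S && vertex_cover S).
  by exists A; rewrite ?mem_index_enum // iA cA.
elim: (index_enum _) => [[]//|S s IHs] [T].
rewrite inE big_cons; case: ifP => [/andP[iS cS] _ _|nS].
  case: (pselect (exists2 S, S \in s & independent S && vertex_cover S)) => [/IHs|nex].
    by rewrite /minn; case: ifP => // _ _; apply/existsP; exists S; rewrite iS cS eqxx.
  (* With no admissible set left in the list, the fold is the default [#|F|], which is at least
     [#|S|]. *)
  rewrite big_hasC; last by apply/hasPn => U Us; apply/negP => UP; case: nex; exists U.
  rewrite (minn_idPl _) ?max_card //.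
  by apply/existsP; exists S; rewrite iS cS eqxx.
case/predU1P => [->|]; first by rewrite nS.
by move=> Ts TP; apply: IHs; exists T.
Qed.

Definition common_nbrs (G : sgraph) (T : {set G}) : {set G} :=
  [set v | [forall u in T, adj u v]].

(** [T] and its common neighbours span a complete bipartite graph. Send [A] into [T] and the rest of
    [F] to common neighbours: as [A] is independent and meets every edge, no edge of [F] stays on
    one side. *)
Lemma subgraph_of_common_nbrs (F G : sgraph) (A : {set F}) (T : {set G}) :
  independent A -> vertex_cover A -> #|A| = #|T| -> #|F| <= #|common_nbrs T| ->
  subgraph F G.
Proof.
move=> iA cA eAT leF; pose N := common_nbrs T.
have NP u v : u \in T -> v \in N -> adj u v.
  by move=> uT; rewrite inE => /forall_inP; apply.
case: (pickP (fun _ : F => true)) => [x0 _|F0]; last first.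
  have F0' (x : F) : False by have := F0 x.
  by exists (fun x => False_rect G (F0' x)); split=> x; case: (F0' x).
have /card_gt0P[y0 _] : 0 < #|N| by apply: leq_trans leF; apply/card_gt0P; exists x0.
pose f x := if x \in A then nth y0 (enum T) (index x (enum A))
            else nth y0 (enum N) (index x (enum F)).
have lt_A x : x \in A -> index x (enum A) < size (enum T).
  by rewrite -cardE -eAT cardE index_mem mem_enum.
have lt_N x : index x (enum F) < size (enum N).
  by rewrite -cardE; apply: leq_trans leF; rewrite cardE index_mem mem_enum.
have fA x : x \in A -> f x \in T.
  by move=> xA; rewrite /f xA -mem_enum mem_nth // lt_A.
have fN x : x \notin A -> f x \in N.
  by move=> /negPf xA; rewrite /f xA -mem_enum mem_nth // lt_N.
have TN x : x \in T -> x \notin N.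
  by move=> xT; apply/negP => /(NP _ _ xT); rewrite adj_irrefl.
exists f; split=> x y.
  have [xA|xA] := boolP (x \in A); have [yA|yA] := boolP (y \in A).
  - rewrite /f xA yA => /eqP; rewrite nth_uniq ?lt_A ?enum_uniq // => /eqP.
    by apply: (index_inj x); rewrite mem_enum.
  - by move=> efxy; have := TN _ (fA _ xA); rewrite efxy fN.
  - by move=> efxy; have := TN _ (fA _ yA); rewrite -efxy fN.
  - rewrite /f (negPf xA) (negPf yA) => /eqP.
    rewrite nth_uniq ?lt_N ?enum_uniq // => /eqP.
    by apply: (index_inj x); rewrite mem_enum.
move=> xy; have /orP[xA|yA] : (x \in A) || (y \in A).
- by move/forallP: cA => /(_ x) /forallP /(_ y); rewrite xy.
- have [yA|yA] := boolP (y \in A); last by apply: NP; [apply: fA|apply: fN].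
  by move/forall_inP: iA => /(_ x xA) /forall_inP /(_ y yA); rewrite xy.
- have [xA|xA] := boolP (x \in A); last by rewrite adj_sym; apply: NP; [apply: fA|apply: fN].
  by move/forall_inP: iA => /(_ x xA) /forall_inP /(_ y yA); rewrite xy.
Qed.

(** The bound is the order of a bipartite member attaining the minimum; with more common neighbours
    it would embed. *)
Lemma common_nbrs_bound FF (degF : degenerate FF) :
  exists m, forall G : sgraph, family_free FF G ->
    forall T : {set G}, #|T| = tau_family degF -> #|common_nbrs T| <= m.
Proof.
rewrite /tau_family; case: ex_minnP => t /asboolP[F [FFF bF tauF]] _.
exists #|F| => G frG T eT; rewrite leqNgt; apply/negP => ltF.
have [A [iA cA eA]] := tau_witness bF.
apply: (frG F FFF); apply: (subgraph_of_common_nbrs iA cA _ (ltnW ltF)).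
by rewrite eA tauF eT.
Qed.

(** Double counting: a vertex has at most [t] neighbours in [W] unless it is a common neighbour of
    some [t.+1]-subset of [W]. There are at most [2 ^ #|W| * m] such exceptions, each adding at most
    [#|W|]. *)
Lemma sum_deg_le_common_nbrs (G : sgraph) (W : {set G}) t m :
  (forall T : {set G}, #|T| = t.+1 -> #|common_nbrs T| <= m) ->
  \sum_(u in W) deg u <= t * #|G| + #|W| * (2 ^ #|W| * m).
Proof.
move=> tm; pose c v := #|[set u in W | adj u v]|.
have -> : \sum_(u in W) deg u = \sum_v c v.
  rewrite /c; under [RHS]eq_bigr do rewrite -sum1dep_card.
  rewrite (exchange_big_dep (mem W)) /=; last by move=> v u _ /andP[].
  apply: eq_bigr => u uW; rewrite /deg -sum1dep_card.
  by apply: eq_bigl => v; rewrite uW.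
pose B := [set v | t < c v].
have cardB : #|B| <= 2 ^ #|W| * m.
  have sub : B \subset \bigcup_(T in powerset W | #|T| == t.+1) common_nbrs T.
    apply/fintype.subsetP => v; rewrite inE => /card_geqP[s [us ss sP]].
    apply/bigcupP; exists [set x in s].
      rewrite powersetE; apply/andP; split.
        by apply/fintype.subsetP => x; rewrite inE => /sP; rewrite inE => /andP[].
      by rewrite cardsE (card_uniqP us) ss.
    rewrite inE; apply/forall_inP => u; rewrite inE => /sP.
    by rewrite inE => /andP[].
  apply: leq_trans (subset_leq_card sub) _.
  apply: leq_trans (_ : \sum_(T in powerset W | #|T| == t.+1) #|common_nbrs T| <= _).
    elim/big_rec2: _ => [|T x y _ le]; first by rewrite cards0.
    by apply: leq_trans (leq_card_setU _ _) _; rewrite leq_add2l.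
  apply: leq_trans (_ : \sum_(T in powerset W | #|T| == t.+1) m <= _).
    by apply: leq_sum => T /andP[_ /eqP/tm].
  rewrite -card_powerset sum_nat_cond_const leq_mul2r; apply/orP; right.
  by apply/subset_leq_card/fintype.subsetP => T; rewrite inE => /andP[].
apply: leq_trans (_ : \sum_v (t + #|W| * (v \in B)) <= _).
  apply: leq_sum => v _; rewrite inE; case: ltnP => [_|]; last by rewrite muln0 addn0.
  rewrite muln1; apply: leq_trans (leq_addl _ _).
  by apply/subset_leq_card/fintype.subsetP => u; rewrite inE => /andP[].
rewrite big_split /= sum_nat_const mulnC leq_add2l -big_distrr /= leq_mul2l.
by rewrite -big_mkcond sum1_card cardB orbT.
Qed.

(** * Real bounds: degree sums and the tail of the powers *)

Local Open Scope ring_scope.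

Lemma turan_number_le n FF : (turan_number n FF <= 'C(n, 2))%N.
Proof. by apply/bigmax_leqP => k _; rewrite -ltnS. Qed.

(** With [w = #|W|], each block contributes at most [2 C (2 w)^(1 + alpha)], and there are at most
    [2 #|G| / w] blocks. *)
Lemma sum_deg_sparse (R : realType) (FF : sgraph -> Prop) (alpha C : R)
    (G : sgraph) (W : {set G}) :
  0 <= alpha ->
  (forall n, (turan_number n FF)%:R <= C * n%:R `^ (1 + alpha)) ->
  0 <= C -> family_free FF G -> (0 < #|W|)%N ->
  (\sum_(u in W) deg u)%:R
    <= (4 * C * 2 `^ (1 + alpha)) * #|W|%:R `^ alpha * #|G|%:R.
Proof.
move=> alpha0 CP C0 frG W0; have [B [leB ->]] := sum_deg_blocks W0.
set w := #|W| in W0 leB *; have a10 : 0 <= 1 + alpha by lra.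
rewrite natr_sum.
apply: le_trans (_ : \sum_(j < (#|G| %/ w).+1) (2 * C * (2 * w%:R) `^ (1 + alpha)) <= _).
  apply: ler_sum => j _.
  apply: le_trans (_ : (2 * turan_number #|W :|: B j| FF)%:R <= _).
    by rewrite ler_nat sum_cross_deg_le.
  rewrite natrM -mulrA ler_wpM2l //; apply: le_trans (CP _) _.
  rewrite ler_wpM2l // ge0_ler_powR // ?nnegrE ?mulr_ge0 //.
  rewrite -natrM ler_nat; apply: leq_trans (leq_card_setU _ _) _.
  by rewrite mul2n -addnn leq_add2l leB.
rewrite sumr_const card_ord -[leLHS]mulr_natr powRM //.
rewrite [w%:R `^ _]powRD; last by rewrite pnatr_eq0 -lt0n W0 implybT.
rewrite powRr1 //.
have le2 : (#|G| %/ w).+1%:R * w%:R <= 2 * #|G|%:R :> R.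
  rewrite -!natrM ler_nat mulSn.
  have := leq_trunc_div #|G| w; have : (w <= #|G|)%N by apply: max_card.
  lia.
have D0 : 0 <= 2 * C * 2 `^ (1 + alpha) * w%:R `^ alpha by rewrite !mulr_ge0 ?powR_ge0.
have := ler_wpM2l D0 le2; set L := leLHS; set M := leRHS => LM.
rewrite [leLHS](_ : _ = L :> R); last by rewrite /L; ring.
by rewrite [leRHS](_ : _ = M :> R) // /M; ring.
Qed.

(** A discrete integral comparison. With [z = y + 1] it reduces to [1 + b / z <= (z / y)^b], where
    [1 + u <= exp u] serves twice: for the power itself and for [1 / z <= ln (z / y)]. *)
Lemma powR_tail_step (R : realType) (y b : R) : 0 < y -> 0 < b ->
  (y + 1) `^ (- (b + 1)) <= (y `^ (- b) - (y + 1) `^ (- b)) / b.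
Proof.
move=> y0 b0; set z := y + 1; have z0 : 0 < z by rewrite /z; lra.
have E : y `^ (- b) = z `^ (- b) * (z / y) `^ b.
  rewrite powRM ?invr_ge0 ?ltW // mulrA -powRD ?addNr ?powRr0 ?mul1r; last first.
    by rewrite lt0r_neq0 // implybT.
  by rewrite -(powR_inv1 (ltW y0)) -powRrM mulN1r.
have L : 1 + b / z <= (z / y) `^ b.
  rewrite /powR gt_eqF ?divr_gt0 //; apply: le_trans (expR_ge1Dx _).
  rewrite lerD2l ler_wpM2l ?(ltW b0) // -[ln _]opprK -lnV ?posrE ?divr_gt0 //.
  have := expR_ge1Dx (ln (z / y)^-1); rewrite lnK ?posrE ?invr_gt0 ?divr_gt0 // => H.
  have zy : (z / y)^-1 = 1 - z^-1.
    by rewrite invf_div /z; field; apply: lt0r_neq0.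
  lra.
rewrite E opprD powRD ?powR_inv1 ?(ltW z0) //; last by rewrite lt0r_neq0 // implybT.
rewrite -[X in _ - X]mulr1 -mulrBr -mulrA ler_wpM2l ?powR_ge0 //.
by rewrite ler_pdivlMr //; move: L; rewrite [b / z]mulrC; lra.
Qed.

(* Sorting [x] decreasingly, the [k]-th value is at most [D k^(alpha - 1)], so
   the powers beyond rank [K] are dominated by the tail of a convergent
   [p]-series, which is bounded here by telescoping. *)
Lemma sum_powR_tail (R : realType) (T : finType) (x : T -> R) (D alpha p : R)
    (b := p * (1 - alpha) - 1) (K : nat) :
  0 <= D -> 0 <= p -> 0 < b -> (0 < K)%N -> (forall v, 0 <= x v) ->
  (forall W : {set T}, (0 < #|W|)%N -> \sum_(v in W) x v <= D * #|W|%:R `^ alpha) ->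
  exists2 W : {set T}, (#|W| <= K)%N &
    \sum_(v | v \notin W) x v `^ p <= D `^ p * (K%:R `^ (- b) / b).
Proof.
move=> D0 p0 b0 K0 x0 xW; pose r : rel T := fun u v => x v <= x u.
pose s := sort r (enum T).
have s_uniq : uniq s by rewrite sort_uniq enum_uniq.
have s_perm : perm_eq (index_enum T) s.
  apply: uniq_perm (index_enum_uniq T) s_uniq _ => v.
  by rewrite mem_index_enum mem_sort mem_enum.
have r_tr : transitive r by move=> u v w uv vw; apply: le_trans vw uv.
have r_tot : total r by move=> u v; apply: le_total.
have r_refl : reflexive r by move=> u; apply: lexx.
have s_sorted : sorted r s by apply: sort_sorted.
exists [set v in take K s].
  rewrite cardsE; apply: leq_trans (card_size _) _.
  by rewrite size_take; case: ltnP.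
have nth_le v0 k : (k < size s)%N -> x (nth v0 s k) <= D * k.+1%:R `^ (alpha - 1).
  move=> ks; pose W := [set v in take k.+1 s].
  have cW : #|W| = k.+1.
    rewrite cardsE (card_uniqP _) ?take_uniq // size_take.
    by case: ltnP => // ?; apply/eqP; rewrite eqn_leq ks andbT.
  have := xW W; rewrite cW => /(_ isT) leW.
  (* The entry of index [k] is the least of the first [k.+1], so [k.+1] copies of it stay below
     their sum. *)
  have : k.+1%:R * x (nth v0 s k) <= D * k.+1%:R `^ alpha.
    apply: le_trans leW; rewrite -cW mulr_natl -sumr_const.
    apply: ler_sum => v; rewrite inE => /(nthP v0)[i].
    rewrite size_take_min leq_min => /andP[ik _].
    rewrite nth_take // => <-.
    apply: (sorted_leq_nth r_tr r_refl v0 s_sorted); rewrite ?inE //.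
    by apply: leq_ltn_trans ks.
  rewrite powRD ?pnatr_eq0 ?implybT // powR_inv1 //.
  by rewrite mulrA ler_pdivlMr ?ltr0Sn // mulrC.
rewrite (perm_big _ s_perm) /= -{1}(cat_take_drop K s) big_cat /=.
rewrite big_seq_cond big_pred0 ?add0r; last first.
  by move=> v; rewrite inE; case: (v \in _).
have -> : \sum_(v <- drop K s | v \notin [set v in take K s]) x v `^ p
        = \sum_(v <- drop K s) x v `^ p.
  rewrite big_seq_cond [RHS]big_seq; apply: eq_bigl => v; rewrite inE.
  case: (boolP (v \in drop K s)) => //= vd.
  move: s_uniq; rewrite -{1}(cat_take_drop K s) cat_uniq => /and3P[_ /hasPn H _].
  exact: H.
case: (pickP (fun _ : T => true)) => [v0 _|T0]; last first.
  rewrite big1_seq ?mulr_ge0 ?powR_ge0 ?invr_ge0 ?(ltW b0) // => v.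
  by have := T0 v.
rewrite (big_nth v0) size_drop.
(* The sign makes [f] nondecreasing, so its increments bound the terms and telescope. *)
pose f i : R := - (K + i)%:R `^ (- b).
apply: le_trans (_ : \sum_(0 <= i < size s - K) (D `^ p / b) * (f i.+1 - f i) <= _).
  rewrite big_nat [leRHS]big_nat; apply: ler_sum => i /= ltis.
  rewrite nth_drop.
  apply: le_trans (_ : (D * (K + i).+1%:R `^ (alpha - 1)) `^ p <= _).
    rewrite ge0_ler_powR ?nnegrE ?mulr_ge0 ?powR_ge0 //.
    by apply: nth_le; rewrite -ltn_subRL.
  rewrite powRM ?powR_ge0 // -mulrA ler_wpM2l ?powR_ge0 // -powRrM.
  (* The choice of [b] gives the exponent of [powR_tail_step]; [0 < K] keeps the base positive even
     at [i = 0]. *)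
  have -> : (alpha - 1) * p = - (b + 1) by rewrite /b; ring.
  have Ki0 : 0 < (K + i)%:R :> R by rewrite ltr0n addn_gt0 K0.
  have := powR_tail_step Ki0 b0; rewrite -natr1 => /le_trans; apply.
  by rewrite /f mulrC addnS -natr1 opprK addrC.
rewrite -big_distrr /= telescope_sumr // /f addn0 opprK -!mulrA ler_wpM2l ?powR_ge0 //.
by rewrite mulrC ler_wpM2r ?invr_ge0 ?(ltW b0) // gerDr oppr_le0 powR_ge0.
Qed.

(** * Choice of constants, and weights forced to the ends of the unit interval *)

Lemma powRN_small (R : realType) (b c eta : R) : 0 < b -> 0 <= c -> 0 < eta ->
  (* As [y^b = c / eta] below, any positive integer above [y] serves. *)
  exists2 K : nat, (0 < K)%N & c * K%:R `^ (- b) <= eta.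
Proof.
move=> b0 c0 eta0; set y := (c / eta) `^ b^-1.
have y0 : 0 <= y by apply: powR_ge0.
exists (Num.bound y).+1 => //; set K := _.+1.
have yK : y <= K%:R by rewrite ltW // (lt_trans (archi_boundP y0)) // ltr_nat.
have K0 : 0 < K%:R `^ b :> R by rewrite powR_gt0.
rewrite powRN ler_pdivrMr // mulrC -ler_pdivrMr //.
have <- : y `^ b = c / eta by rewrite -powRrM mulVf ?gt_eqF // powRr1 // divr_ge0 // ltW.
by rewrite ge0_ler_powR ?nnegrE // ltW.
Qed.

(* [x - x `^ p] vanishes on [0, 1] only at the endpoints, so the assumption that
   [\sum x] and [\sum x `^ p] nearly agree pushes each value to [0] or [1]. *)
Lemma extremal_weights (R : realType) (T : finType) (x : T -> R) (p e eta : R)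
    (t : nat) (W : {set T}) (U := [set v | 1 - e < x v]) :
  1 < p -> 0 < e -> e * t.+1%:R <= 1 / 4 -> e `^ (p - 1) * t.+1%:R <= 1 / 2 ->
  0 < eta -> eta < 1 / 4 -> 3 * eta < e * (1 - (1 - e) `^ (p - 1)) ->
  eta < e `^ p ->
  (forall v, 0 <= x v <= 1) ->
  \sum_(v in W) x v <= t%:R + eta ->
  \sum_(v | v \notin W) x v `^ p <= eta ->
  t%:R - eta <= \sum_v x v `^ p ->
  #|U| = t /\ forall v, v \notin U -> x v <= e.
Proof.
move=> p1 e0 et ept eta0 eta4 etag etap x01 sumW sumWc sumT.
have t0 : 0 <= t%:R :> R by [].
rewrite -natr1 in et ept.
have e4 : e <= 1 / 4 by nra.
have x0 v : 0 <= x v by case/andP: (x01 v).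
have x1 v : x v <= 1 by case/andP: (x01 v).
have p0 : 0 < p by lra.
have pow1 : 1 = 1 `^ (p - 1) :> R by rewrite powR1.
have xp v : x v `^ p = x v * x v `^ (p - 1) by rewrite mulr_powRB1.
have splitT : \sum_v x v `^ p = \sum_(v in W) x v `^ p + \sum_(v | v \notin W) x v `^ p.
  by rewrite (bigID (mem W)).
have xp_le v : x v `^ p <= x v.
  rewrite xp -[leRHS]mulr1 ler_wpM2l // [leRHS]pow1.
  by rewrite ge0_ler_powR ?nnegrE //; lra.
have small_out v : v \notin W -> x v < e.
  move=> vW; rewrite ltNge; apply/negP => ex.
  have : x v `^ p <= eta.
    apply: le_trans sumWc; rewrite (bigD1 v) //= lerDl.
    by apply: sumr_ge0 => *; apply: powR_ge0.
  have : e `^ p <= x v `^ p by rewrite ge0_ler_powR ?nnegrE // ltW.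
  by lra.
have dich v : v \in W -> x v <= e \/ 1 - e < x v.
  move=> vW; case: (lerP (x v) e) => [|ex]; first by left.
  case: (lerP (x v) (1 - e)) => [xe|]; last by right.
  (* All terms [x u - x u^p] are nonnegative, and over [W] they total at most
     [(t + eta) - (t - 2 eta)]. *)
  have gap : x v - x v `^ p <= 3 * eta.
    apply: le_trans (_ : \sum_(u in W) (x u - x u `^ p) <= _).
      rewrite (bigD1 v) //= lerDl; apply: sumr_ge0 => u _.
      by rewrite subr_ge0.
    by rewrite sumrB; lra.
  have le1 : x v `^ (p - 1) <= (1 - e) `^ (p - 1).
    by rewrite ge0_ler_powR ?nnegrE //; lra.
  (* The first factor is least at [e], the second at [1 - e]; the product would exceed [3 * eta],
     against [gap]. *)
  have : e * (1 - (1 - e) `^ (p - 1)) <= x v * (1 - x v `^ (p - 1)).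
    apply: ler_pM; [lra| |lra|lra].
    rewrite subr_ge0 [leRHS]pow1 ge0_ler_powR ?nnegrE //; lra.
  by rewrite [leRHS]mulrBr mulr1 -xp; lra.
have UW : U \subset W.
  apply/fintype.subsetP => v; rewrite inE => xv; apply: contraTT xv => /small_out.
  by rewrite -leNgt; lra.
split; last first.
  move=> v; rewrite inE => vU; have [vW|/small_out/ltW //] := boolP (v \in W).
  by case: (dich v vW) => // vU'; rewrite vU' in vU.
apply/eqP; rewrite eqn_leq; apply/andP; split.
(* If [#|U| > t], the weights in [U] would total at least [(t + 1) (1 - e) >= t + 3 / 4], more than
   [t + eta]. *)
- rewrite leqNgt; apply/negP => ltU.
  have : #|U|%:R * (1 - e) <= t%:R + eta.
    apply: le_trans sumW; rewrite (big_setID U) /= (finset.setIidPr UW).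
    rewrite mulr_natl -sumr_const; apply: ler_wpDr.
      by apply: sumr_ge0 => *.
    by apply: ler_sum => v; rewrite inE => /ltW.
  have : t%:R + 1 <= #|U|%:R :> R by rewrite natr1 ler_nat.
  nra.
(* In [W] off [U], weights are at most [e], so their powers total at most
   [e^(p - 1) (t + eta) <= 1 / 2]. As [2 eta < 1 / 2], this leaves [#|U| > t - 1]. *)
- have bnd : \sum_(v in W) x v `^ p <= #|U|%:R + e `^ (p - 1) * (t%:R + eta).
    apply: le_trans (_ : \sum_(v in W) ((v \in U)%:R + e `^ (p - 1) * x v) <= _).
      apply: ler_sum => v vW; rewrite inE; case: ltP => /= [_|xe].
        have := powR_ge0 e (p - 1); have := xp_le v; have := x1 v; have := x0 v.
        nra.
      rewrite add0r xp mulrC ler_wpM2r // ge0_ler_powR ?nnegrE ?(ltW e0) //; first lra.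
      by case: (dich v vW) => // h; move: xe; rewrite leNgt h.
    rewrite big_split /= -big_distrr /= lerD ?ler_wpM2l ?powR_ge0 //.
    rewrite -natr_sum ler_nat -sum1_card big_mkcond [leqRHS]big_mkcond /=.
    by apply: leq_sum => v _; case: (v \in W); case: (v \in U).
  have ep0 := powR_ge0 e (p - 1).
  have : t%:R - 1 < #|U|%:R :> R by nra.
  by rewrite ltrBlDr natr1 ltr_nat ltnS.
Qed.

(** Every condition on [e] is a positive upper bound. [eta] is chosen after [e], and its bounds are
    positive because [(1 - e)^(p - 1) < 1]. *)
Lemma extremal_constants (R : realType) (p eps : R) (t : nat) : 1 < p -> 0 < eps ->
  exists e eta : R, [/\ 0 < e, e <= eps, e * t.+1%:R <= 1 / 4 &
    e `^ (p - 1) * t.+1%:R <= 1 / 2] /\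
    [/\ 0 < eta, eta < 1 / 4, 3 * eta < e * (1 - (1 - e) `^ (p - 1)) & eta < e `^ p].
Proof.
move=> p1 eps0; have t0 : 0 < t.+1%:R :> R by [].
have t1 : 1 <= t.+1%:R :> R by rewrite ler1n.
have p10 : 0 < p - 1 by lra.
have pow1 : 1 = 1 `^ (p - 1) :> R by rewrite powR1.
set T := t.+1%:R in t0 t1 *.
(* [a] solves [a^(p - 1) * T = 1 / 2]. *)
pose a := (1 / 2 / T) `^ (p - 1)^-1.
have a0 : 0 < a by rewrite powR_gt0 // !divr_gt0.
pose e := Num.min eps (Num.min (1 / 4 / T) a).
have e0 : 0 < e by rewrite !lt_min eps0 a0 !divr_gt0.
have eT : e * T <= 1 / 4.
  by rewrite -ler_pdivlMr // /e !ge_min lexx orbT.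
have e4 : e <= 1 / 4 by nra.
have ea : e `^ (p - 1) * T <= 1 / 2.
  rewrite -ler_pdivlMr //.
  have <- : a `^ (p - 1) = 1 / 2 / T.
    by rewrite -powRrM mulVf ?gt_eqF // powRr1 // !divr_ge0 // ltW.
  rewrite ge0_ler_powR ?nnegrE ?(ltW p10) ?(ltW e0) ?(ltW a0) //.
  by rewrite /e !ge_min lexx !orbT.
have g0 : 0 < e * (1 - (1 - e) `^ (p - 1)).
  rewrite mulr_gt0 // subr_gt0 [ltRHS]pow1.
  by rewrite gt0_ltr_powR ?nnegrE //; lra.
have ep0 : 0 < e `^ p by rewrite powR_gt0.
set g := e * _ in g0; set ep := e `^ p in ep0.
exists e, (Num.min (1 / 8) (Num.min (g / 4) (ep / 2))).
split; first by split=> //; rewrite /e ge_min lexx.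
split; first by rewrite !lt_min !divr_gt0.
- by rewrite gt_min; apply/orP; left; lra.
- rewrite -ltr_pdivlMl // gt_min; apply/orP; right; rewrite gt_min; apply/orP; left.
  by rewrite -/g; lra.
- by rewrite !gt_min; apply/orP; right; apply/orP; right; rewrite -/ep; lra.
Qed.

(** * From the asymptotic hypothesis to the theorem *)

Unset Implicit Arguments.

Local Open Scope classical_set_scope.
Local Open Scope ring_scope.

(** Adding ['C(N, 2)] to the constant absorbs the values of [n] below the threshold [N]. *)
Lemma turan_bigO_bound (R : realType) (FF : sgraph -> Prop) (beta : R) :
  0 < beta ->
  (fun n : nat => (turan_number n FF)%:R : R^o)
    =O_\oo (fun n : nat => n%:R `^ beta : R^o) ->
  exists2 C : R, 0 < C & forall n, (turan_number n FF)%:R <= C * n%:R `^ beta.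
Proof.
move=> beta0 /eqO_exP[k k0 [N _ NP]].
have C0 : 0 <= 'C(N, 2)%:R :> R by [].
exists (k + 'C(N, 2)%:R) => [|n]; first by rewrite ltr_wpDr.
have [leNn|ltnN] := leqP N n.
  have := NP n leNn; rewrite !ger0_norm ?powR_ge0 // => /le_trans; apply.
  by rewrite ler_wpM2r ?powR_ge0 // lerDl.
(* [n = 0] is treated apart, since [n^beta >= 1] fails there. *)
have [->|n0] := posnP n.
  move: (turan_number_le 0 FF).
  by rewrite bin0n leqn0 => /eqP->; apply: mulr_ge0; rewrite ?powR_ge0 ?addr_ge0 ?(ltW k0).
have n1 : 1 <= n%:R `^ beta.
  by rewrite -[leLHS](powRr0 n%:R); apply: ler_powR; rewrite ?ler1n ?ltW.
apply: le_trans (_ : 'C(N, 2)%:R * 1 <= _); last by rewrite ler_pM ?lerDr // ltW.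
by rewrite mulr1 ler_nat (leq_trans (turan_number_le n FF)) // leq_bin2l // ltnW.
Qed.

Theorem theorem1p2 (R : realType) (FF : sgraph -> Prop) (degF : degenerate FF)
    (alpha : R) (alpha_ge0 : 0 <= alpha) (alpha_lt1 : alpha < 1)
    (exF : (fun n : nat => (turan_number n FF)%:R : R^o)
             =O_\oo (fun n : nat => n%:R `^ (1 + alpha) : R^o))
    (tauF : (2 <= tau_family degF)%N)
    (p : R) (hp : 1 / (1 - alpha) < p) :
  forall eps : R, 0 < eps ->
  exists2 delta : R, 0 < delta & exists n0 : nat,
  forall n : nat, (n0 <= n)%N ->
  forall G : sgraph, #|G| = n -> family_free FF G ->
    ((tau_family degF)%:R - 1 - delta) * n%:R `^ p <= degree_power p G ->
  exists U : {set G},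
    [/\ #|U| = (tau_family degF - 1)%N,
        forall u, u \in U -> (1 - eps) * n%:R <= (deg u)%:R :> R
      & forall v, v \notin U -> (deg v)%:R <= eps * n%:R :> R].
Proof.
(* Here [t] is the target size of [U], one less than [tau_family degF]. *)
move=> eps eps0; pose t := (tau_family degF - 1)%N.
have tE : tau_family degF = t.+1 by rewrite /t; lia.
have q0 : 0 < 1 - alpha by lra.
(* The hypothesis on [p] says exactly that the tail exponent is positive. *)
have b0 : 0 < p * (1 - alpha) - 1 by move: hp; rewrite ltr_pdivrMr //; lra.
have p1 : 1 < p by nra.
have p0 : 0 < p by lra.
have [C C0 CP] : exists2 C : R, 0 < C &
    forall n, (turan_number n FF)%:R <= C * n%:R `^ (1 + alpha).
  by apply: turan_bigO_bound exF; lra.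
pose D := 4 * C * 2 `^ (1 + alpha).
have D0 : 0 <= D by rewrite !mulr_ge0 ?powR_ge0 // ltW.
have [e [eta [[e0 le_e et ept] [eta0 eta4 etag etap]]]] := extremal_constants t p1 eps0.
set b := _ - 1 in b0.
have [K K0 KP] : exists2 K : nat, (0 < K)%N & D `^ p / b * K%:R `^ (- b) <= eta.
  by apply: powRN_small; rewrite // divr_ge0 ?powR_ge0 // ltW.
have [m mP] := common_nbrs_bound degF.
(* [M] bounds the excess over [t * n] of the degree sum of any [K] vertices, uniformly in [n]. *)
pose M := (K * (2 ^ K * m))%N.
(* [delta] is [eta] itself; the threshold ensures [M / n <= eta]. *)
exists eta => //; exists (Num.bound (M%:R / eta)).+1 => n len G cG frG hG.
have n0 : (0 < n)%N by apply: leq_trans len.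
have nR0 : 0 < n%:R :> R by rewrite ltr0n.
have np0 : 0 < n%:R `^ p by rewrite powR_gt0.
have Mn : M%:R / n%:R <= eta.
  rewrite ler_pdivrMr // mulrC -ler_pdivrMr // ltW //.
  apply: lt_trans (archi_boundP _) _; first by rewrite divr_ge0 // ltW.
  by rewrite ltr_nat.
pose x (v : G) : R := (deg v)%:R / n%:R.
have x01 v : 0 <= x v <= 1.
  by rewrite divr_ge0 ?(ltW nR0) // ler_pdivrMr // mul1r ler_nat -cG max_card.
have x0 v : 0 <= x v by case/andP: (x01 v).
have sumx (W : {set G}) : \sum_(v in W) x v = (\sum_(v in W) deg v)%:R / n%:R.
  by rewrite natr_sum mulr_suml.
have sparse (W : {set G}) : (0 < #|W|)%N -> \sum_(v in W) x v <= D * #|W|%:R `^ alpha.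
  move=> W0; rewrite sumx ler_pdivrMr // -cG.
  exact: (sum_deg_sparse alpha_ge0 CP (ltW C0) frG W0).
have [W WK sumWc] := sum_powR_tail D0 (ltW p0) b0 K0 x0 sparse.
have sumW : \sum_(v in W) x v <= t%:R + eta.
  have : (\sum_(v in W) deg v <= t * n + M)%N.
    rewrite -cG; apply: leq_trans (sum_deg_le_common_nbrs W _) _.
      by move=> T cT; apply: (mP G frG T); rewrite cT tE.
    by rewrite leq_add2l leq_mul // leq_mul // leq_pexp2l.
  rewrite sumx -(ler_nat R) natrD natrM => le.
  rewrite ler_pdivrMr // mulrDl; apply: le_trans le _.
  by rewrite lerD2l -ler_pdivrMr.
have sumT : t%:R - eta <= \sum_v x v `^ p.
  have -> : \sum_v x v `^ p = degree_power p G / n%:R `^ p.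
    rewrite /degree_power mulr_suml; apply: eq_bigr => v _.
    by rewrite powRM ?invr_ge0 // -(powR_inv1 (ltW nR0)) powRAC powR_inv1 // ltW.
  by rewrite ler_pdivlMr //; move: hG; rewrite tE -natr1 addrK.
have {}sumWc : \sum_(v | v \notin W) x v `^ p <= eta.
  by apply: le_trans sumWc _; rewrite mulrA mulrAC.
have [cU outU] := extremal_weights p1 e0 et ept eta0 eta4 etag etap x01 sumW sumWc sumT.
exists [set v | 1 - e < x v]%SET; split=> // [u|v /outU].
- by rewrite inE ltr_pdivlMr // => /ltW; apply: le_trans; rewrite ler_pM2r //; lra.
- by rewrite ler_pdivrMr // => /le_trans; apply; rewrite ler_pM2r.
Qed.
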